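(* Let $G$ be a finite simple undirected graph and $\delta\in[\eta(G),1)$. If $x^*$ maximizes $\mathbf{e}^\top x$ over all independent clique solutions $x$ of $\mathrm{LCP}_\delta(G)$, then $x^*$ also maximizes $\mathbf{e}^\top x$ over all solutions $x$ of $\mathrm{LCP}_\delta(G)$.
   Context: For a graph $G$ with adjacency matrix $A$ and $\delta>0$, $\mathrm{LCP}_\delta(G)$ is the problem: find $x\in\mathbb{R}^{V(G)}$ with $x\ge0$, $(I+\delta A)x-\mathbf{e}\ge 0$, $x^\top((I+\delta A)x-\mathbf{e})=0$ ($\mathbf{e}$ the all-ones vector). Two cliques are independent if no vertex of one is adjacent to any vertex of the other. An independent clique solution is a solution whose support $\{i:x_i>0\}$ is a union of pairwise independent cliques. $\alpha(G)$ is the independence number, $\omega(G)$ the clique number, and $\eta(G)=\max\Big\{\frac{\omega(G)-3+\sqrt{(\omega(G)-3)^2+4(\omega(G)-1)}}{2(\omega(G)-1)},\ \frac{\alpha(G)(\omega(G)-1)-\omega(G)}{\alpha(G)(\omega(G)-1)}\Big\}$. *)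

(* Defs.v *)
From mathcomp Require Import all_boot all_order all_algebra reals.

Set Implicit Arguments.
Unset Strict Implicit.
Unset Printing Implicit Defensive.

Import Order.TTheory GRing.Theory Num.Theory.
Local Open Scope ring_scope.

(* A graph on a finite vertex type V is given by its adjacency relation
   [e : rel V]; it is simple and undirected when e is irreflexive and
   symmetric, which are hypotheses of the theorem. *)

Section Graph.
Variables (V : finType) (e : rel V).

Definition clique (C : {set V}) : bool :=
  [forall u in C, forall v in C, (u != v) ==> e u v].

Definition independent_set (S : {set V}) : bool :=
  [forall u in S, forall v in S, ~~ e u v].

Definition clique_number : nat := \max_(C : {set V} | clique C) #|C|.

Definition independence_number : nat :=
  \max_(S : {set V} | independent_set S) #|S|.

Definition independent_cliques (C D : {set V}) : bool :=
  [forall u in C, forall v in D, ~~ e u v].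

Definition union_of_independent_cliques (S : {set V}) : Prop :=
  exists F : {set {set V}},
    [/\ forall C, C \in F -> clique C,
        forall C D, C \in F -> D \in F -> C != D -> independent_cliques C D
      & S = cover F].

End Graph.

Section LCP.
Variables (R : realType) (V : finType) (e : rel V).

(* Vectors of R^V are column vectors indexed by 'I_#|V|; the coordinate of a
   vertex v is the one at [enum_rank v]. *)

Definition adjacency_matrix : 'M[R]_#|V| :=
  \matrix_(i, j) (e (enum_val i) (enum_val j))%:R.

Definition ones : 'cV[R]_#|V| := const_mx 1.

Definition nonneg_vec (x : 'cV[R]_#|V|) : Prop := forall i, 0 <= x i 0.

Definition LCP_solution (delta : R) (x : 'cV[R]_#|V|) : Prop :=
  let w := (1%:M + delta *: adjacency_matrix) *m x - ones in
  [/\ nonneg_vec x, nonneg_vec w & x^T *m w = 0].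

Definition positive_support (x : 'cV[R]_#|V|) : {set V} :=
  [set v | 0 < x (enum_rank v) 0].

Definition independent_clique_solution (delta : R) (x : 'cV[R]_#|V|) : Prop :=
  LCP_solution delta x /\ union_of_independent_cliques e (positive_support x).

Definition objective (x : 'cV[R]_#|V|) : R := (ones^T *m x) 0 0.

(* For an edgeless graph (clique number 1) both denominators vanish; with the
   convention a / 0 = 0 this gives eta = 0, so that case is not excluded. *)
Definition eta : R :=
  let w : R := (clique_number e)%:R in
  let a : R := (independence_number e)%:R in
  Num.max
    ((w - 3 + Num.sqrt ((w - 3) ^+ 2 + 4 * (w - 1))) / (2 * (w - 1)))
    ((a * (w - 1) - w) / (a * (w - 1))).

End LCP.

Definition maximizes (R : realType) (X : Type) (f : X -> R) (P : X -> Prop)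
    (x : X) : Prop :=
  P x /\ forall y, P y -> f y <= f x.

(* Main.v *)
(** The solutions of LCP_delta are the KKT points of the quadratic program
    max 2 e^T x - x^T (I + delta A) x over x >= 0, and at a solution this
    payoff equals e^T x. So it suffices to find a maximizer of the program whose
    support is a union of independent cliques, i.e. contains no induced path
    P3. Take a maximizer of minimal support: I + delta A is then positive
    definite on the support, as one could otherwise move along a nonpositive
    direction, without decreasing the payoff, until a coordinate vanishes.

    If the support contains an induced P3, the vector (delta, -1, delta) gives
    2 delta^2 < 1. With the first term of eta this forces omega = 2 and
    delta^2 + delta >= 1. Positive definiteness then excludes induced P4, C4 and
    claws, so in this triangle-free graph the P3 is a connected component of the
    support; but solving the equations on an isolated P3 makes its middle
    coordinate negative. *)
Require Import Defs.
From mathcomp Require Import boolp classical_sets topology normedtype derive.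
From mathcomp Require Import all_boot all_order all_algebra reals ring lra.

Set Implicit Arguments.
Unset Strict Implicit.
Unset Printing Implicit Defensive.

Import Order.TTheory GRing.Theory Num.Theory.
Import numFieldNormedType.Exports.
Local Open Scope ring_scope.

(** * The quadratic program: expansion along a line and optimality conditions *)

Section QuadraticProgram.
Variables (R : realType) (V : finType) (e : rel V) (delta : R).
Implicit Types (x y d : V -> R) (t : R) (u v w : V).

Definition nbr_sum x u : R := \sum_v (e u v)%:R * x v.

(** For symmetric [e], half the partial derivative of [payoff] at [u]; also minus the LCP
    residual. *)
Definition slack x u : R := 1 - x u - delta * nbr_sum x u.

(* At x this is 2 e^T x - x^T (I + delta A) x. *)
Definition payoff x : R := \sum_u x u * (1 + slack x u).

(** The quadratic form of I + delta A. *)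
Definition energy d : R := \sum_u d u * (d u + delta * nbr_sum d u).

Definition payoff_maximizer x : Prop :=
  (forall u, 0 <= x u) /\
  forall y, (forall u, 0 <= y u) -> payoff y <= payoff x.

Definition pos_support x : {set V} := [set u | 0 < x u].

Lemma nbr_sumD x t d u :
  nbr_sum (fun v => x v + t * d v) u = nbr_sum x u + t * nbr_sum d u.
Proof. by rewrite /nbr_sum mulr_sumr -big_split; apply: eq_bigr => v _ /=; ring. Qed.

Lemma nbr_sum_ge0 x u : (forall v, 0 <= x v) -> 0 <= nbr_sum x u.
Proof. by move=> x0; apply: sumr_ge0 => v _; rewrite mulr_ge0. Qed.

Lemma nbr_sum_sym (e_sym : symmetric e) x y :
  \sum_u x u * nbr_sum y u = \sum_u y u * nbr_sum x u.
Proof.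
under eq_bigr do rewrite mulr_sumr.
rewrite exchange_big; apply: eq_bigr => u _ /=; rewrite mulr_sumr.
by apply: eq_bigr => v _; rewrite e_sym; ring.
Qed.

Lemma payoffD (e_sym : symmetric e) x t d :
  payoff (fun v => x v + t * d v)
  = payoff x + 2 * t * (\sum_u d u * slack x u) - t ^+ 2 * energy d.
Proof.
(* The last summand is the mismatch of the two cross terms, zero since A is symmetric. *)
have -> : payoff (fun v => x v + t * d v) =
    payoff x + 2 * t * (\sum_u d u * slack x u) - t ^+ 2 * energy d
    + delta * t * (\sum_u d u * nbr_sum x u - \sum_u x u * nbr_sum d u).
  rewrite /payoff /energy -sumrB !mulr_sumr -sumrN -!big_split /=.
  by apply: eq_bigr => u _; rewrite /slack nbr_sumD; ring.
by rewrite (nbr_sum_sym e_sym d x) subrr mulr0 addr0.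
Qed.

Lemma nbr_sum_delta u v : nbr_sum (fun w => (w == u)%:R) v = (e v u)%:R.
Proof.
rewrite /nbr_sum (bigD1 u) //= eqxx mulr1 big1 ?addr0 // => w /negPf->.
exact: mulr0.
Qed.

Lemma payoffD_delta (e_sym : symmetric e) (e_irr : irreflexive e) x t u :
  payoff (fun w => x w + t * (w == u)%:R) = payoff x + 2 * t * slack x u - t ^+ 2.
Proof.
have sum_delta (F : V -> R) : \sum_v (v == u)%:R * F v = F u.
  by rewrite (bigD1 u) //= eqxx mul1r big1 ?addr0 // => v /negPf->; exact: mul0r.
by rewrite payoffD // /energy !sum_delta nbr_sum_delta e_irr eqxx mulr0 addr0 mulr1.
Qed.

(** Moving coordinate [u] by t changes the payoff by t (2 [slack x u] - t), a gain for t =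
    [slack x u] unless that is zero. *)
Lemma maximizer_stationary (e_sym : symmetric e) (e_irr : irreflexive e) x :
  payoff_maximizer x ->
  (forall u, slack x u <= 0) /\ (forall u, 0 < x u -> slack x u = 0).
Proof.
move=> [x0 xmax].
have slack_le0 u : slack x u <= 0.
  rewrite leNgt; apply/negP => g0.
  have := xmax (fun w => x w + slack x u * (w == u)%:R).
  rewrite payoffD_delta // => /(_ _)/wrap[|].
    by move=> w; rewrite addr_ge0 // mulr_ge0 // ltW.
  have : 0 < slack x u ^+ 2 by rewrite exprn_gt0.
  by lra.
split=> // u xu; apply/eqP; rewrite eq_le slack_le0 leNgt; apply/negP => g0.
(* The one-variable optimal step, truncated so that the coordinate stays nonnegative. *)
pose t := Num.max (- x u) (slack x u).
have t0 : t < 0 by rewrite gt_max oppr_lt0 xu.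
have tg : slack x u <= t by rewrite le_max lexx orbT.
have tx : - x u <= t by rewrite le_max lexx.
have := xmax (fun w => x w + t * (w == u)%:R).
rewrite payoffD_delta // => /(_ _)/wrap[|].
  by move=> w; case: eqP => [->|_]; rewrite ?mulr1 ?mulr0 ?addr0 //; lra.
have : 0 < t * (2 * slack x u - t) by rewrite nmulr_rgt0 //; lra.
by lra.
Qed.

(** A has nonnegative entries; hence a nonzero direction of nonpositive energy must have a negative
    coordinate. *)
Lemma energy_gt0 (delta_gt0 : 0 < delta) d u :
  (forall v, 0 <= d v) -> d u != 0 -> 0 < energy d.
Proof.
move=> d0 du; have term_ge0 v : 0 <= d v * (d v + delta * nbr_sum d v).
  by rewrite mulr_ge0 ?addr_ge0 ?mulr_ge0 ?nbr_sum_ge0 // ltW.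
rewrite /energy (bigD1 u) //= ltr_pwDl ?sumr_ge0 //.
have du0 : 0 < d u by rewrite lt_neqAle eq_sym du d0.
by rewrite mulr_gt0 // ltr_pwDl // mulr_ge0 ?nbr_sum_ge0 // ltW.
Qed.

(** Minimum ratio test: the ray leaves the orthant at the least [x u / - d u] over the negative
    coordinates of [d]. *)
Lemma ray_exit x d v : (forall u, 0 <= x u) -> d v < 0 ->
  exists t w, [/\ 0 <= t, d w < 0, x w + t * d w = 0
    & forall u, 0 <= x u + t * d u].
Proof.
move=> x0 dv.
case: (arg_minP (P := fun u => d u < 0) (fun u => x u / - d u) dv) => w dw wmin.
exists (x w / - d w), w; split => //.
- by rewrite divr_ge0 // oppr_ge0 ltW.
- by field; rewrite lt_eqF.
move=> u; have [du|du] := ltP (d u) 0; last first.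
  by rewrite addr_ge0 // mulr_ge0 // divr_ge0 // oppr_ge0 ltW.
have := wmin u du; rewrite ler_pdivlMr ?oppr_gt0 //; lra.
Qed.

Lemma minimal_maximizer_energy (e_sym : symmetric e) (e_irr : irreflexive e)
    (delta_gt0 : 0 < delta) x :
  payoff_maximizer x ->
  (forall y, payoff_maximizer y -> (#|pos_support x| <= #|pos_support y|)%N) ->
  forall d u, (forall v, v \notin pos_support x -> d v = 0) -> d u != 0 ->
  0 < energy d.
Proof.
move=> xM xmin d u dsupp du; rewrite ltNge; apply/negP => Qd.
have [v dv] : exists v, d v < 0.
  apply/existsP; apply: contraLR Qd => /existsPn dN.
  by rewrite -ltNge; apply: (energy_gt0 delta_gt0 _ du) => v; rewrite leNgt.
have [x0 xmax] := xM; have [_ xstat] := maximizer_stationary e_sym e_irr xM.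
have [t [w [t0 dw xw ynneg]]] := ray_exit x0 dv.
pose y u := x u + t * d u.
have yM : payoff_maximizer y.
  split=> // z /xmax /le_trans; apply.
  (* No first-order term: [slack x] vanishes on the support of [x], and [d] vanishes off it. *)
  rewrite payoffD // big1 => [|a _].
    by rewrite mulr0 addr0 lerDl oppr_ge0 mulr_ge0_le0 ?sqr_ge0.
  have [ax|/dsupp->] := boolP (a \in pos_support x); last by rewrite mul0r.
  by rewrite xstat ?mulr0 //; rewrite inE in ax.
have := xmin y yM; rewrite leqNgt => /negP; apply; apply: proper_card.
apply/properP; split.
  apply/subsetP => a; rewrite inE; apply: contraLR => ax.
  rewrite /y dsupp // mulr0 addr0 -leNgt leNgt; by rewrite inE in ax.
exists w; last by rewrite inE /y xw ltxx.
by apply/negPn/negP => /dsupp dw0; rewrite dw0 ltxx in dw.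
Qed.

(** Coefficients [cs] on [s] are extended by zero: off [s], [index v s] is [size s], where the
    truncated list returns the default 0. *)
Lemma big_uniq_supp (s : seq V) (cs : seq R) (F : V -> R) v0 : uniq s ->
  \sum_v F v * nth 0 (take (size s) cs) (index v s)
  = \sum_(i < size s) F (nth v0 s i) * nth 0 cs i.
Proof.
move=> us; rewrite (bigID [in s]) /= addrC big1 ?add0r => [|v vs]; last first.
  rewrite memNindex // nth_default ?mulr0 // size_take_min; exact: geq_minl.
rewrite -big_uniq // (big_nth v0) big_mkord; apply: eq_bigr => i _.
by rewrite index_uniq // nth_take.
Qed.

Lemma energy_seq (s : seq V) (cs : seq R) v0 : uniq s ->
  energy (fun v => nth 0 (take (size s) cs) (index v s))
  = \sum_(i < size s) nth 0 cs i * (nth 0 cs i + delta *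
      \sum_(j < size s) (e (nth v0 s i) (nth v0 s j))%:R * nth 0 cs j).
Proof.
move=> us; rewrite /energy; under eq_bigr do rewrite mulrC.
rewrite (big_uniq_supp _ _ v0) //; apply: eq_bigr => i _.
by rewrite index_uniq // nth_take // /nbr_sum (big_uniq_supp _ _ v0) // mulrC.
Qed.

(** * Existence of maximizers *)

Lemma payoff_max_exists (delta_gt0 : 0 < delta) : exists x, payoff_maximizer x.
Proof.
(* With n = [#|V|], a coordinate above n + 2 forces a payoff below n - (n + 1)^2 < 0, worse than the
   zero vector, which lies in the box. *)
pose B : R := #|V|%:R + 2.
pose vec (r : 'rV[R]_#|V|) : V -> R := fun v => r ord0 (enum_rank v).
pose K : set 'rV[R]_#|V| := [set r | forall i, `[0, B]%classic (r ord0 i)]%classic.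
have B0 : 0 <= B by rewrite addr_ge0.
have K0 : (K !=set0)%classic.
  by exists 0 => i /=; rewrite mxE in_itv /= lexx.
have Kcompact : compact K.
  apply: (@rV_compact R #|V| (fun=> `[0, B]%classic)) => i.
  exact: segment_compact.
have coordC v : continuous (fun r => vec r v) by move=> r; exact: coord_continuous.
have sumC (F : V -> 'rV[R]_#|V| -> R) : (forall v, continuous (F v)) ->
    continuous (fun r => \sum_v F v r).
  by move=> FC; apply: continuous_big => //; exact: add_continuous.
have mulC (f g : 'rV[R]_#|V| -> R) : continuous f -> continuous g ->
    continuous (fun r => f r * g r).
  by move=> fC gC r; exact: (continuousM (fC r) (gC r)).
have subC (f g : 'rV[R]_#|V| -> R) : continuous f -> continuous g ->
    continuous (fun r => f r - g r).
  by move=> fC gC r; exact: (continuousB (fC r) (gC r)).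
have cstC (a : R) : continuous (fun _ : 'rV[R]_#|V| => a) by exact: cst_continuous.
have payoffC : continuous (fun r => payoff (vec r)).
  apply: (sumC _) => u; apply: (mulC (vec^~ u)) => //.
  have slackC : continuous (fun r => slack (vec r) u).
    apply: (subC _ _ _) => //; first exact: (subC _ (vec^~ u)).
    by apply: (mulC _ _ _) => //; apply: (sumC _) => v; exact: (mulC _ (vec^~ v)).
  by move=> r; exact: (continuousD (cstC 1 r) (slackC r)).
have [c cK cmax] := compact_EVT_max K0 Kcompact (continuous_subspaceT payoffC).
exists (vec c); split=> [u|y y0].
  by move: cK => /set_mem/(_ (enum_rank u)) /=; rewrite in_itv /= => /andP[].
have inK z : (forall u, 0 <= z u) -> (forall u, z u <= B) ->
    payoff z <= payoff (vec c).
  move=> z0 zB; pose r : 'rV[R]_#|V| := \row_i z (enum_val i).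
  have -> : z = vec r by apply: funext => v; rewrite /vec mxE enum_rankK.
  by apply: cmax; apply/mem_set => i /=; rewrite mxE in_itv /= z0 zB.
have [/forallP yB|/forallPn [u]] := boolP [forall u, y u <= B].
  exact: inK.
rewrite -ltNge => Bu; apply: (@le_trans _ _ (payoff (fun _ => 0))); last exact: inK.
rewrite {2}/payoff big1 => [|v _]; last exact: mul0r.
(* Drop the nonnegative interaction term and complete the square. *)
have term_le v : y v * (1 + slack y v) <= 1 - (y v - 1) ^+ 2.
  have := nbr_sum_ge0 v y0; have := y0 v; rewrite /slack; move: (nbr_sum y v) => s.
  move=> yv s0; have : 0 <= y v * (delta * s) by rewrite !mulr_ge0 // ltW.
  by lra.
apply: (le_trans (ler_sum _ (fun v _ => term_le v))).
rewrite sumrB sumr_const (bigD1 u) //= subr_le0.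
apply: (@le_trans _ _ ((y u - 1) ^+ 2)); last first.
  by rewrite lerDl sumr_ge0 // => v _; exact: sqr_ge0.
move: Bu; rewrite /B -[1 *+ _]/(#|V|%:R); move: (ler0n R #|V|).
move: (#|V|%:R : R) => n n0 Bu.
have : (n + 1) ^+ 2 <= (y u - 1) ^+ 2 by rewrite ler_pXn2r ?nnegrE //; lra.
by have := sqr_ge0 n; lra.
Qed.

Lemma minimal_maximizer_exists (delta_gt0 : 0 < delta) :
  exists2 x, payoff_maximizer x &
    forall y, payoff_maximizer y -> (#|pos_support x| <= #|pos_support y|)%N.
Proof.
have [x0 x0M] := payoff_max_exists delta_gt0.
pose P n := `[< exists2 x, payoff_maximizer x & #|pos_support x| = n >].
have exP : exists n, P n by exists #|pos_support x0|; apply/asboolP; exists x0.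
case: (ex_minnP exP) => n /asboolP[x xM <-] nmin.
by exists x => // y yM; apply: nmin; apply/asboolP; exists y.
Qed.

End QuadraticProgram.

(** * Unions of independent cliques and the clique number *)

Section Graph.
Variables (V : finType) (e : rel V).
Hypotheses (e_sym : symmetric e) (e_irr : irreflexive e).
Implicit Types (S C : {set V}) (i j k l u v : V).

(** Without induced P3, being equal or adjacent is an equivalence relation on [S]; its classes, the
    closed neighbourhoods [nb u], are the cliques. *)
Lemma union_of_independent_cliquesP S :
  (forall i j k, i \in S -> j \in S -> k \in S ->
    e i j -> e j k -> i != k -> e i k) ->
  union_of_independent_cliques e S.
Proof.
move=> trS; pose nb u := [set v in S | (v == u) || e u v].
have nbS u v : v \in nb u -> v \in S by rewrite inE => /andP[].
have nb_clos u v w : u \in S -> v \in nb u -> w \in S -> e v w -> w \in nb u.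
  rewrite !inE => uS /andP[vS /predU1P[->|uv]] wS vw; rewrite wS ?vw ?orbT //=.
  by have [//|wu] := eqVneq w u; apply: trS vS wS uv vw _; rewrite // eq_sym.
have nb_eq u v : u \in S -> v \in nb u -> nb v = nb u.
  move=> uS vu; have vS := nbS _ _ vu; apply/setP => w; apply/idP/idP => wN.
    have wS := nbS _ _ wN; move: wN; rewrite inE => /andP[_ /predU1P[->//|vw]].
    exact: nb_clos vw.
  have wS := nbS _ _ wN; rewrite inE wS /=.
  have [//|wv /=] := eqVneq w v.
  move: vu wN; rewrite !inE => /andP[_ vu] /andP[_ wN].
  case/predU1P: vu => [vE|uv]; case/predU1P: wN => [wu|uw].
  - by rewrite vE wu eqxx in wv.
  - by rewrite vE.
  - by rewrite wu e_sym.
  - by apply: trS vS uS wS _ uw _; rewrite 1?e_sym // eq_sym.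
exists (nb @: S); split.
- move=> _ /imsetP[u uS ->]; apply/forall_inP => v vN; apply/forall_inP => w.
  rewrite -(nb_eq u v uS vN) inE => /andP[_ /predU1P[->|->]]; rewrite ?eqxx //.
  exact: implybT.
- move=> _ _ /imsetP[u uS ->] /imsetP[v vS ->] uv.
  apply/forall_inP => a aN; apply/forall_inP => b bN; apply: contraNN uv => ab.
  rewrite -(nb_eq u a uS aN) -(nb_eq v b vS bN) eq_sym; apply/eqP.
  by apply: nb_eq; rewrite ?inE ?ab ?orbT ?andbT (nbS _ _ aN, nbS _ _ bN).
- apply/setP => v; apply/idP/bigcupP => [vS|[_ /imsetP[u _ ->]]]; last exact: nbS.
  by exists (nb v); rewrite ?imset_f // inE vS eqxx.
Qed.

Lemma card_clique_le C : clique e C -> (#|C| <= clique_number e)%N.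
Proof. exact: leq_bigmax_cond. Qed.

Lemma edge_neq u v : e u v -> u != v.
Proof. by apply: contraTneq => ->; rewrite e_irr. Qed.

Lemma edge_clique_number i j : e i j -> (2 <= clique_number e)%N.
Proof.
move=> ij; have := @card_clique_le [set i; j]; rewrite cards2 edge_neq //; apply.
apply/forall_inP => u; rewrite !inE => /orP[]/eqP->; apply/forall_inP => v;
  rewrite !inE => /orP[]/eqP->; by rewrite ?eqxx ?ij ?implybT // e_sym ij implybT.
Qed.

Lemma triangle_clique_number i j k :
  e i j -> e j k -> e i k -> (3 <= clique_number e)%N.
Proof.
move=> ij jk ik; have <- : #|[set i; j; k]| = 3%N.
  by rewrite setUC cardsU1 cards2 !inE negb_or ![k == _]eq_sym !edge_neq.
apply: card_clique_le; apply/forall_inP => u uC; apply/forall_inP => v vC.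
apply/implyP; move: uC vC; rewrite !inE => /orP[/orP[]|]/eqP-> /orP[/orP[]|]/eqP->;
  by rewrite ?eqxx ?ij ?jk ?ik // e_sym ?ij ?jk ?ik.
Qed.

Variables (R : realType) (delta : R).
Hypotheses (delta_gt0 : 0 < delta) (delta_lt1 : delta < 1).
Hypothesis eta_le_delta : eta R e <= delta.

(** The first term of [eta] is the larger root of (w - 1) t^2 - (w - 3) t - 1, whose leading
    coefficient is positive. *)
Lemma eta_quadratic : (2 <= clique_number e)%N ->
  let w : R := (clique_number e)%:R in
  1 <= (w - 1) * delta ^+ 2 - (w - 3) * delta.
Proof.
rewrite -(ler_nat R) => w2 /=; move: eta_le_delta; rewrite /eta ge_max => /andP[+ _].
move: ((clique_number e)%:R : R) w2 => w w2; have w1 : 0 < 2 * (w - 1) by lra.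
rewrite ler_pdivrMr // -lerBrDl.
(* [D] is the discriminant and [t] is 2 (w - 1) delta - (w - 3); t^2 - D is 4 (w - 1) times the
   value of the quadratic at delta. *)
set D := (X in Num.sqrt X); set t := (X in _ <= X) => Dt.
have D0 : 0 <= D by rewrite addr_ge0 ?sqr_ge0 //; lra.
have t0 : 0 <= t by apply: le_trans Dt; exact: sqrtr_ge0.
have : D <= t ^+ 2 by rewrite -(sqr_sqrtr D0) ler_pXn2r ?nnegrE ?sqrtr_ge0.
rewrite /D /t => Dt2.
have : 0 <= 4 * (w - 1) * ((w - 1) * delta ^+ 2 - (w - 3) * delta - 1) by lra.
by rewrite pmulr_rge0 ?subr_ge0 //; lra.
Qed.

(** * Induced subgraphs of a support on which the form is positive definite *)

Section Support.
Variable x : V -> R.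
Hypothesis x_ge0 : forall u, 0 <= x u.
Hypothesis stationary : forall u, 0 < x u -> slack e delta x u = 0.
Hypothesis energy_pos : forall d u,
  (forall v, v \notin pos_support x -> d v = 0) -> d u != 0 -> 0 < energy e delta d.
Let S := pos_support x.

Lemma energy_seq_gt0 u s (cs : seq R) : uniq (u :: s) ->
  all [in S] (u :: s) -> nth 0 cs 0 != 0 ->
  0 < \sum_(i < (size s).+1) nth 0 cs i * (nth 0 cs i + delta *
      \sum_(j < (size s).+1)
        (e (nth u (u :: s) i) (nth u (u :: s) j))%:R * nth 0 cs j).
Proof.
move=> us /allP sS c0; rewrite -[(size s).+1]/(size (u :: s)) -energy_seq //.
apply: (energy_pos (u := u)); last by rewrite /= eqxx; case: cs c0.
move=> v vS; rewrite memNindex; last by apply: contra vS => /sS.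
by rewrite nth_default // size_take_min geq_minl.
Qed.

(** Against -1 in the middle, delta at each end minimizes the energy, which is then 1 - 2
    delta^2. *)
Lemma induced_P3_delta i j k : i \in S -> j \in S -> k \in S ->
  e i j -> e j k -> i != k -> ~~ e i k -> 2 * delta ^+ 2 < 1.
Proof.
move=> iS jS kS ij jk ik /negPf nik.
have us : uniq [:: i; j; k] by rewrite /= !inE !negb_or ik !edge_neq.
have sS : all [in S] [:: i; j; k] by rewrite /= iS jS kS.
have := energy_seq_gt0 (cs := [:: delta; -1; delta]) us sS.
rewrite /= lt0r_neq0 // => /(_ isT).
rewrite !big_ord_recl !big_ord0 /= !e_irr (e_sym j i) (e_sym k j) (e_sym k i).
rewrite ij jk nik /=.
lra.
Qed.

(** Each end carries -delta times the coefficient of its neighbour; the energy is 2 (1 - delta -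
    delta^2). *)
Lemma induced_P4_delta i j k l :
  i \in S -> j \in S -> k \in S -> l \in S -> e i j -> e j k -> e k l ->
  i != k -> i != l -> j != l -> ~~ e i k -> ~~ e i l -> ~~ e j l ->
  delta ^+ 2 + delta < 1.
Proof.
move=> iS jS kS lS ij jk kl nik nil njl /negPf ik /negPf il /negPf jl.
have us : uniq [:: i; j; k; l] by rewrite /= !inE !negb_or nik nil njl !edge_neq.
have sS : all [in S] [:: i; j; k; l] by rewrite /= iS jS kS lS.
have := energy_seq_gt0 (cs := [:: delta; -1; 1; - delta]) us sS.
rewrite /= lt0r_neq0 // => /(_ isT).
rewrite !big_ord_recl !big_ord0 /= !e_irr
  !(e_sym l) !(e_sym k i) !(e_sym k j) (e_sym j i).
rewrite ij jk kl ik il jl /=; lra.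
Qed.

(** With -1 at the centre and delta at the leaves, the energy is 1 - 3 delta^2. *)
Lemma induced_claw_delta i j k l :
  i \in S -> j \in S -> k \in S -> l \in S -> e i j -> e i k -> e i l ->
  j != k -> j != l -> k != l -> ~~ e j k -> ~~ e j l -> ~~ e k l ->
  3 * delta ^+ 2 < 1.
Proof.
move=> iS jS kS lS ij ik il njk njl nkl /negPf jk /negPf jl /negPf kl.
have us : uniq [:: i; j; k; l] by rewrite /= !inE !negb_or njk njl nkl !edge_neq.
have sS : all [in S] [:: i; j; k; l] by rewrite /= iS jS kS lS.
have := energy_seq_gt0 (cs := [:: -1; delta; delta; delta]) us sS.
rewrite /= oppr_eq0 oner_eq0 => /(_ isT).
rewrite !big_ord_recl !big_ord0 /= !e_irr
  !(e_sym l) !(e_sym k i) !(e_sym k j) (e_sym j i).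
rewrite ij jk kl ik il jl /=; lra.
Qed.

(** The alternating vector has energy 4 (1 - 2 delta). *)
Lemma induced_C4_delta i j k l :
  i \in S -> j \in S -> k \in S -> l \in S -> e i j -> e j k -> e k l -> e i l ->
  i != k -> j != l -> ~~ e i k -> ~~ e j l -> 2 * delta < 1.
Proof.
move=> iS jS kS lS ij jk kl il nik njl /negPf ik /negPf jl.
have us : uniq [:: i; j; k; l] by rewrite /= !inE !negb_or nik njl !edge_neq.
have sS : all [in S] [:: i; j; k; l] by rewrite /= iS jS kS lS.
have := energy_seq_gt0 (cs := [:: 1; -1; 1; -1]) us sS.
rewrite /= oner_eq0 => /(_ isT).
rewrite !big_ord_recl !big_ord0 /= !e_irr
  !(e_sym l) !(e_sym k i) !(e_sym k j) (e_sym j i).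
rewrite ij jk kl ik il jl /=; lra.
Qed.

(** For w >= 3, the quantity in [eta_quadratic] is 2 delta^2 - (w - 3) delta (1 - delta) <= 2
    delta^2 < 1. *)
Lemma clique_number_le2 : 2 * delta ^+ 2 < 1 -> (clique_number e <= 2)%N.
Proof.
move=> d2; rewrite leqNgt; apply/negP => w3.
have := eta_quadratic (ltnW w3); have : 3 <= (clique_number e)%:R :> R by rewrite ler_nat.
move: ((clique_number e)%:R : R) => w {}w3 /= h.
have : 0 <= (w - 3) * (delta * (1 - delta)).
  have dd : 0 <= delta * (1 - delta) by apply: mulr_ge0; rewrite ?subr_ge0 ltW.
  by apply: mulr_ge0 => //; rewrite subr_ge0.
by lra.
Qed.

Lemma support_P3_free i j k : i \in S -> j \in S -> k \in S ->
  e i j -> e j k -> i != k -> e i k.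
Proof.
move=> iS jS kS ij jk ik; apply/negPn/negP => nik.
have d2 := induced_P3_delta iS jS kS ij jk ik nik.
have w2 := clique_number_le2 d2.
have triangle_free a b c : e a b -> e b c -> ~~ e a c.
  move=> ab bc; apply/negP => ac.
  by have := leq_trans (triangle_clique_number ab bc ac) w2.
have golden : 1 <= delta ^+ 2 + delta.
  have w2' := edge_clique_number ij; have := eta_quadratic w2'.
  have -> : clique_number e = 2%N by apply/eqP; rewrite eqn_leq w2.
  by move=> /=; lra.
have half : 1 < 2 * delta.
  have : 0 < delta * (1 - delta) by rewrite mulr_gt0 ?subr_gt0.
  by lra.
have no_P4 a b c l : a \in S -> b \in S -> c \in S -> l \in S ->
    e a b -> e b c -> e c l -> a != c -> b != l -> a != l -> e a l.
  move=> aS bS cS lS ab bc cl ac bl al; apply/negPn/negP => nal.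
  have := induced_P4_delta aS bS cS lS ab bc cl ac al bl (triangle_free _ _ _ ab bc)
            nal (triangle_free _ _ _ bc cl).
  by rewrite ltNge golden.
have no_C4 a b c l : a \in S -> b \in S -> c \in S -> l \in S ->
    e a b -> e b c -> e c l -> a != c -> b != l -> ~~ e a l.
  move=> aS bS cS lS ab bc cl ac bl; apply/negP => al.
  have := induced_C4_delta aS bS cS lS ab bc cl al ac bl (triangle_free _ _ _ ab bc)
            (triangle_free _ _ _ bc cl).
  by lra.
(* A further neighbour [l] of the end [a] yields the path l, a, b, c: an induced P4, or a C4 if [l]
   and [c] are adjacent. *)
have no_ext a b c l : a \in S -> b \in S -> c \in S -> l \in S ->
    e a b -> e b c -> a != c -> b != l -> ~~ e a l.
  move=> aS bS cS lS ab bc ac bl; apply/negP => al.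
  have lc : l != c.
    by apply: contraTneq al => ->; exact: triangle_free ab bc.
  have la : e l a by rewrite e_sym.
  have lb : l != b by rewrite eq_sym.
  have := no_P4 l a b c lS aS bS cS la ab bc lb ac lc.
  by apply/negP; exact: (no_C4 l a b c).
have no_claw l : l \in S -> i != l -> k != l -> ~~ e j l.
  move=> lS il kl; apply/negP => jl.
  have ji : e j i by rewrite e_sym.
  have ijl : ~~ e i l by exact: triangle_free jl.
  have kjl : ~~ e k l by apply: triangle_free jl; rewrite e_sym.
  have := induced_claw_delta jS iS kS lS ji jk jl ik il kl nik ijl kjl.
  (* By [golden], 3 delta^2 < 1 would give delta >= 1 - delta^2 > 2/3, hence 3 delta^2 > 4/3. *)
  by have := mulr_gt0 delta_gt0 delta_gt0; nra.
have off v : (v \in S -> False) -> x v = 0.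
  move=> vS; apply/eqP; rewrite eq_le x_ge0 andbT leNgt; apply/negP => xv.
  by apply: vS; rewrite inE.
(* Within the support, the ends are adjacent only to [j], and [j] only to [i] and [k]. *)
have end_sum a c : a \in S -> c \in S -> e a j -> e j c -> a != c ->
    nbr_sum e x a = x j.
  move=> aS cS aj jc ac; rewrite /nbr_sum (bigD1 j) //= aj mul1r big1 ?addr0 // => v vj.
  have [av|_] := boolP (e a v); last exact: mul0r.
  rewrite off ?mulr0 // => vS.
  have jv : j != v by rewrite eq_sym.
  by have := no_ext a j c v aS jS cS vS aj jc ac jv; rewrite av.
have mid_sum : nbr_sum e x j = x i + x k.
  rewrite /nbr_sum (bigD1 i) //= (bigD1 k) 1?eq_sym //= jk e_sym ij !mul1r big1 ?addr0 //.
  move=> v /andP[vi vk]; have [jv|_] := boolP (e j v); last exact: mul0r.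
  rewrite off ?mulr0 // => vS.
  by have := no_claw v vS; rewrite ![_ == v]eq_sym jv vi vk => /(_ isT isT).
have xpos u : u \in S -> 0 < x u by rewrite /S inE.
have := stationary (xpos _ iS); rewrite /slack (end_sum i k) //.
have := stationary (xpos _ jS); rewrite /slack mid_sum.
have := stationary (xpos _ kS); rewrite /slack (end_sum k i)
  1?[k == i]eq_sym // 1?e_sym //.
have := xpos _ jS; move: (x i) (x j) (x k) => a b c b0 hk hj hi.
(* Eliminate a and c from the three stationarity equations; the right side is negative by [half],
   the left positive by [d2]. *)
have : b * (1 - 2 * delta ^+ 2) = 1 - 2 * delta.
  have ea : a = 1 - delta * b by lra.
  have ec : c = 1 - delta * b by lra.
  by move: hj; rewrite ea ec; lra.
have : 0 < b * (1 - 2 * delta ^+ 2) by rewrite mulr_gt0 // subr_gt0.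
by lra.
Qed.

End Support.
End Graph.

(** * Column vectors as functions on the vertices *)

Section Coordinates.
Variables (R : realType) (V : finType) (e : rel V) (delta : R).
Implicit Type y : 'cV[R]_#|V|.

Definition coords y : V -> R := fun v => y (enum_rank v) 0.

Lemma sum_enum_rank (F : 'I_#|V| -> R) : \sum_i F i = \sum_v F (enum_rank v).
Proof. by rewrite (reindex _ (onW_bij _ (@enum_rank_bij V))). Qed.

Lemma objectiveE y : objective y = \sum_v coords y v.
Proof.
rewrite /objective mxE sum_enum_rank; apply: eq_bigr => v _.
by rewrite !mxE mul1r.
Qed.

Lemma LCP_residualE y v :
  ((1%:M + delta *: adjacency_matrix R e) *m y - ones R V) (enum_rank v) 0
  = - slack e delta (coords y) v.
Proof.
rewrite mulmxDl mul1mx -scalemxAl !mxE sum_enum_rank.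
under eq_bigr do rewrite mxE !enum_rankK.
by rewrite /slack /nbr_sum /coords; ring.
Qed.

Lemma LCP_solutionE y :
  LCP_solution e delta y <->
  [/\ forall v, 0 <= coords y v, forall v, slack e delta (coords y) v <= 0
    & \sum_v coords y v * slack e delta (coords y) v = 0].
Proof.
have comp : (y^T *m ((1%:M + delta *: adjacency_matrix R e) *m y - ones R V)) 0 0
    = - \sum_v coords y v * slack e delta (coords y) v.
  rewrite mxE sum_enum_rank -sumrN; apply: eq_bigr => v _.
  by rewrite LCP_residualE mxE mulrN.
rewrite /LCP_solution; split=> [[y0 w0 yw]|[y0 s0 ys]]; split.
- by move=> v; exact: y0.
- by move=> v; have := w0 (enum_rank v); rewrite LCP_residualE oppr_ge0.
- by apply/eqP; rewrite -oppr_eq0 -comp yw mxE.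
- by move=> i; have := y0 (enum_val i); rewrite /coords enum_valK.
- by move=> i; rewrite -[i]enum_valK LCP_residualE oppr_ge0.
- by apply/matrixP => i j; rewrite !ord1 comp ys oppr0 mxE.
Qed.

End Coordinates.

Theorem theorem4p12 (R : realType) (V : finType) (e : rel V)
    (e_sym : symmetric e) (e_irr : irreflexive e)
    (delta : R) (delta_gt0 : 0 < delta)
    (eta_le_delta : eta R e <= delta) (delta_lt1 : delta < 1)
    (xs : 'cV[R]_#|V|) :
  maximizes (@objective R V) (independent_clique_solution e delta) xs ->
  maximizes (@objective R V) (LCP_solution e delta) xs.
Proof.
move=> [[xsol _] xsmax]; split=> // y ysol.
have [x xM xmin] := minimal_maximizer_exists e delta_gt0.
have [slack_le0 xstat] := maximizer_stationary e_sym e_irr xM.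
have [x0 xmax] := xM.
(* Complementarity removes the slack term from the payoff. *)
have objE z : LCP_solution e delta z -> objective z = payoff e delta (coords z).
  move=> /LCP_solutionE[_ _ zs]; rewrite objectiveE /payoff.
  under [RHS]eq_bigr do rewrite mulrDr mulr1.
  by rewrite big_split /= zs addr0.
pose X : 'cV[R]_#|V| := \col_i x (enum_val i).
have XE : coords X = x by apply: funext => v; rewrite /coords mxE enum_rankK.
have Xsol : LCP_solution e delta X.
  apply/LCP_solutionE; rewrite XE; split=> //; apply: big1 => v _.
  have := x0 v; rewrite le_eqVlt => /predU1P[<-|/xstat->]; first exact: mul0r.
  exact: mulr0.
have Xclique : independent_clique_solution e delta X.
  split=> //; have -> : positive_support X = pos_support x.
    by apply/setP => v; rewrite !inE -[X _ _]/(coords X v) XE.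
  apply: union_of_independent_cliquesP => // i j k iS jS kS ij jk ik.
  apply: (support_P3_free e_sym e_irr delta_gt0 delta_lt1 eta_le_delta x0 xstat
    _ iS jS kS ij jk ik).
  exact: minimal_maximizer_energy e_sym e_irr delta_gt0 _ xM xmin.
(* The chain is: objective of [y] = its payoff <= payoff of [x] = objective of [X] <= objective of
   [xs]. *)
apply: (le_trans _ (xsmax X Xclique)); rewrite !objE // XE; apply: xmax.
by have [] := (LCP_solutionE e delta y).1 ysol.
Qed.
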